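(* Let $S_0\in\mathbb{N}_+^*$, let $S_{i+1}=f(S_i)$ for all $i\ge 0$, and let $c_0=|[\mu(S_0)]|$. Then the pre-period of the sequence $(S_i)_{i\ge0}$ is at most $$2\left(\max S_1-|[S_1]|\right)+\log_{\sqrt{2}}\log_{5/4}\frac{\max(c_0,10)}{8}+62.$$
   Context: $\mathbb{N}_+^*$ denotes the set of finite nonempty multisets of positive integers. For a multiset $S$: $|S|$ is the number of elements counted with multiplicity; $[S]$ is the set of distinct elements of $S$; $\mathrm{mult}_S(x)$ is the multiplicity of $x$ in $S$; $\mu(S)$ is the multiset of multiplicities, having one entry $\mathrm{mult}_S(x)$ for each $x\in[S]$; $A+B$ is the multiset sum (multiplicities add). The map is $f(S)=[S]+\mu(S)$. A multiset $S$ is a member of an Inventory Loop if $f^k(S)=S$ for some $k\ge 1$. The pre-period of $(S_i)_{i\ge0}$ is the least $p\ge 0$ such that $S_p$ is a member of an Inventory Loop. $\max S$ is the largest element of $S$. *)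

(* Defs.v *)
From HB Require Import structures.
From mathcomp Require Import all_boot all_order all_algebra.
From mathcomp Require Import finmap multiset.
From mathcomp Require Import reals exp.

Set Implicit Arguments.
Unset Strict Implicit.
Unset Printing Implicit Defensive.

Import Order.TTheory GRing.Theory Num.Theory.

Local Open Scope fset_scope.
Local Open Scope mset_scope.
Local Open Scope nat_scope.

(* Finite multisets of naturals are finitely supported functions {mset nat},
   [S x] being the multiplicity of [x] in [S]; this predicate cuts out the
   nonempty multisets of positive integers. *)
Definition posmset (S : {mset nat}) : Prop := S <> mset0 /\ 0 \notin S.

Definition distinct (S : {mset nat}) : {fset nat} := finsupp S.

Definition mults (S : {mset nat}) : {mset nat} :=
  seq_mset [seq S x | x <- distinct S].

Definition inventory (S : {mset nat}) : {mset nat} :=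
  seq_mset (distinct S) `+` mults S.

Definition maxms (S : {mset nat}) : nat := \max_(x <- S) x.

Definition in_loop (S : {mset nat}) : Prop :=
  exists k : nat, 1 <= k /\ iter k inventory S = S.

Definition is_preperiod (S : nat -> {mset nat}) (p : nat) : Prop :=
  in_loop (S p) /\ forall q : nat, in_loop (S q) -> p <= q.

(* Only meaningful for 0 < b, b != 1 and 0 < x. *)
Definition logb (R : realType) (b x : R) : R := (ln x / ln b)%R.

(* Main.v *)
(* Let D_i be the set of elements of S_i, n_i its size, M_i the list of
   multiplicities and c_i the number of distinct ones, so S_(i+1) = D_i + M_i.

   All but at most c_i entries of M_(i+1) equal 1, and k distinct multiplicities
   bigger than 1 need k (k + 1) / 2 such entries; hence c_(i+2)^2 <= 8 c_i. After
   2 + log_(sqrt 2) log_(5/4) (c_0 / 8) steps c_i <= 10, and 7 steps later at most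
   4 entries exceed 1 forever.

   Since D_i only grows and max S_i can grow by at most 2 after S_1 (unless it
   stays <= 7), the number of steps i with D_i <> D_(i+1) is bounded by
   max S_1 - n_1 + 2; it remains to show that, up to an additive constant, there
   are at most two steps per new element. While no element is new, M_(i+1) is a
   function of M_i; for n_i <= 8 its orbits are short by enumeration. For
   n_i >= 9, M_i consists of one large entry n_i - l, at most three small entries Q
   and ones. This leaves finitely many pairs (Q, l) up to translation of the large
   entry with n_i; a potential on them (together with the presence in D_i of
   n_i - 2 and n_i - 3) decreases by 1 at each step and increases by at most 2
   per new large element, until the orbit closes up. *)
Require Import Defs.
From HB Require Import structures.
From mathcomp Require Import all_boot all_order all_algebra.
From mathcomp Require Import finmap multiset.
From mathcomp Require Import reals exp.
From mathcomp Require Import boolp zify lra.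

Set Implicit Arguments.
Unset Strict Implicit.
Unset Printing Implicit Defensive.

Import Order.TTheory GRing.Theory Num.Theory.

Local Open Scope fset_scope.
Local Open Scope mset_scope.
Local Open Scope nat_scope.

(** * Multiplicities of an inventory *)

Definition multl (A : {mset nat}) : seq nat := [seq A x | x <- finsupp A].

Definition is_orbit (S : nat -> {mset nat}) : Prop :=
  forall i, S i.+1 = inventory (S i).

Lemma size_multl (A : {mset nat}) : size (multl A) = #|` distinct A|.
Proof. by rewrite size_map. Qed.

Lemma multl_gt0 (A : {mset nat}) x : x \in multl A -> 0 < x.
Proof. by case/mapP => y; rewrite msuppE in_mset => yA ->. Qed.

Lemma inventoryE (A : {mset nat}) x :
  inventory A x = (x \in A) + count_mem x (multl A).
Proof.
rewrite /inventory msetE2 /mults !mset_seqE /distinct.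
by rewrite count_uniq_mem ?fset_uniq // msuppE.
Qed.

Lemma in_inventory (A : {mset nat}) x :
  (x \in inventory A) = (x \in A) || (x \in multl A).
Proof.
by rewrite in_mset inventoryE addn_gt0 -has_count has_pred1; case: (x \in A).
Qed.

Lemma eq_inventory (A B : {mset nat}) :
  A =i B -> perm_eq (multl A) (multl B) -> inventory A = inventory B.
Proof.
by move=> AB /permP pAB; apply/msetP => x; rewrite !inventoryE AB pAB.
Qed.

Lemma card_distinct_mults (A : {mset nat}) :
  #|` distinct (mults A)| = size (undup (multl A)).
Proof.
apply/perm_size/uniq_perm; rewrite ?undup_uniq ?fset_uniq // => x.
by rewrite mem_undup /distinct msuppE in_mset /mults mset_seqE -has_count has_pred1.
Qed.

Lemma perm_supp_inventory (A : {mset nat}) :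
  perm_eq (finsupp (inventory A))
    (undup (multl A) ++ [seq x <- finsupp A | x \notin multl A]).
Proof.
apply: uniq_perm; rewrite ?fset_uniq //.
  rewrite cat_uniq undup_uniq filter_uniq ?fset_uniq // andbT.
  by apply/hasPn => x; rewrite mem_filter mem_undup => /andP[].
move=> x; rewrite msuppE in_inventory mem_cat mem_undup mem_filter msuppE.
by case: (x \in multl A); rewrite ?orbT ?orbF.
Qed.

Lemma map_const (T : Type) (T' : Type) (c : T') (s : seq T) :
  [seq c | _ <- s] = nseq (size s) c.
Proof. by elim: s => //= _ s ->. Qed.

(** An old element that is not itself a multiplicity is counted only through the support of [A];
    these elements give the block of ones. *)
Lemma perm_multl_inventory (A : {mset nat}) :
  perm_eq (multl (inventory A))
    ([seq (v \in A) + count_mem v (multl A) | v <- undup (multl A)] ++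
     nseq (count [predC multl A] (finsupp A)) 1).
Proof.
rewrite /multl (perm_trans (perm_map _ (perm_supp_inventory A))) //.
rewrite map_cat -size_filter -/(multl A).
have -> : [seq inventory A i | i <- [seq x <- finsupp A | x \notin multl A]] =
          nseq (size [seq x <- finsupp A | [predC multl A] x]) 1.
  have e : {in [seq x <- finsupp A | x \notin multl A], inventory A =1 fun=> 1}.
    move=> x; rewrite mem_filter msuppE => /andP[xM xA].
    by rewrite inventoryE xA (count_memPn xM).
  by rewrite (iffLR (eq_in_map _ _ _) e) map_const.
by rewrite perm_cat2r (eq_map (inventoryE A)).
Qed.

Lemma sum_count_mem (T : eqType) (s t : seq T) :
  uniq s -> {subset t <= s} -> \sum_(x <- s) count_mem x t = size t.
Proof.
move=> us; elim: t => [|y t IH] sts /=; first by rewrite big1_eq.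
rewrite big_split /= IH => [|x xt]; last by apply: sts; rewrite in_cons xt orbT.
rewrite -add1n; congr (_ + _); rewrite (bigD1_seq y) ?sts ?mem_head //= eqxx.
by rewrite big1 // => x /negPf; rewrite eq_sym => ->.
Qed.

(** Both summands of the inventory, the support and the multiplicities, contribute one entry per
    distinct element of [A]. *)
Lemma sumn_multl_inventory (A : {mset nat}) :
  sumn (multl (inventory A)) = (size (multl A)).*2.
Proof.
rewrite sumnE big_map -addnn.
under eq_bigr do rewrite inventoryE.
rewrite big_split /= sum_count_mem ?fset_uniq //; last first.
  by move=> x xM; rewrite msuppE in_inventory xM orbT.
congr (_ + _); rewrite size_map.
rewrite -(sum_count_mem (s := finsupp (inventory A))) ?fset_uniq //.
  by apply: eq_bigr => x _; rewrite count_uniq_mem ?fset_uniq // msuppE.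
by move=> x; rewrite !msuppE in_inventory => ->.
Qed.

(** * The number of distinct multiplicities *)

Lemma size_multl_inventory_ge (A : {mset nat}) :
  size (multl A) <= size (multl (inventory A)).
Proof.
rewrite !size_map; apply: uniq_leq_size; rewrite ?fset_uniq // => x.
by rewrite !msuppE in_inventory => ->.
Qed.

Lemma size_multl_inventory_le (A : {mset nat}) :
  size (multl (inventory A)) <= size (multl A) + size (undup (multl A)).
Proof.
rewrite (perm_size (perm_multl_inventory A)) size_cat size_map size_nseq.
by rewrite addnC leq_add2r (leq_trans (count_size _ _)) // size_map.
Qed.

Lemma size_big_inventory (A : {mset nat}) :
  size [seq x <- multl (inventory A) | 1 < x] <= size (undup (multl A)).
Proof.
rewrite (perm_size (perm_filter _ (perm_multl_inventory A))) filter_cat filter_nseq /=.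
by rewrite cats0 size_filter (leq_trans (count_size _ _)) ?size_map.
Qed.

Lemma size_undup_big (s : seq nat) : (forall x, x \in s -> 0 < x) ->
  size (undup s) <= (size (undup [seq x <- s | 1 < x])).+1.
Proof.
move=> s0; apply: (@uniq_leq_size _ _ (1 :: undup [seq x <- s | 1 < x])).
  exact: undup_uniq.
move=> x; rewrite mem_undup => xs; rewrite in_cons mem_undup mem_filter xs andbT.
by have := s0 _ xs; case: x {xs} => [|[]].
Qed.

Lemma size_undup_inventory (A : {mset nat}) :
  size (undup (multl (inventory A))) <= (size (undup (multl A))).+1.
Proof.
apply: leq_trans (size_undup_big (@multl_gt0 _)) _.
by rewrite ltnS (leq_trans (size_undup _)) ?size_big_inventory.
Qed.

Lemma leq_sum_undup (T : eqType) (s : seq T) (F : T -> nat) :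
  \sum_(x <- undup s) F x <= \sum_(x <- s) F x.
Proof.
elim: s => //= x s IH; rewrite big_cons; case: ifP => _; rewrite ?big_cons.
  exact: leq_trans IH (leq_addl _ _).
by rewrite leq_add2l.
Qed.

(** By pigeonhole some entry is at least [size s]; the induction removes it. *)
Lemma triangular_sum (s : seq nat) :
  uniq s -> (forall x, x \in s -> 0 < x) -> size s * (size s).+1 <= 2 * sumn s.
Proof.
have [m] := ubnP (size s); elim: m s => // m IH s; rewrite ltnS => sm us s0.
case: (posnP (size s)) => [/size0nil -> //|n0].
have [x xs lex] : exists2 x, x \in s & size s <= x.
  case: (altP (@hasP _ (fun x => size s <= x) s)) => [[x xs ?]|/hasPn hs].
    by exists x.
  have : size s <= size (iota 1 (size s).-1).
    apply: uniq_leq_size us _ => x xs; rewrite mem_iota s0 //=.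
    by have := hs _ xs; lia.
  by rewrite size_iota; lia.
have ur : uniq (rem x s) by exact: rem_uniq.
have r0 y : y \in rem x s -> 0 < y by move/mem_rem/s0.
have := IH (rem x s); rewrite size_rem // => /(_ _ ur r0) h.
have -> : sumn s = x + sumn (rem x s) by have /perm_sumn -> := perm_to_rem xs.
have {h} : (size s).-1 * (size s).-1.+1 <= 2 * sumn (rem x s) by apply: h; rewrite prednK.
nia.
Qed.

(* Apart from [1] and the multiplicity of [1], the [k] distinct multiplicities
   [w] after two steps come from distinct entries [v > 1] of [multl (inventory A)],
   each occurring at least [w - 1] times, and there are at most
   [size (undup (multl A))] such occurrences. *)
Lemma size_undup_inventory2 (A : {mset nat}) :
  exists2 k, k * k.+1 <= 2 * size (undup (multl A)) &
    size (undup (multl (inventory (inventory A)))) <= k.+2.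
Proof.
set B := inventory A; pose P := [seq x <- multl B | 1 < x].
pose F v := (v \in B) + count_mem v (multl B).
pose V := undup [seq x <- [seq F v | v <- undup P] | 1 < x].
have V1 x : x \in V -> 1 < x by rewrite mem_undup mem_filter => /andP[].
have uV : uniq V := undup_uniq _.
exists (size V); last first.
  apply: (@uniq_leq_size _ _ [:: 1, F 1 & V]); first exact: undup_uniq.
  move=> x; rewrite mem_undup => xM; have := multl_gt0 xM.
  rewrite (perm_mem (perm_multl_inventory B)) mem_cat in xM.
  case/orP: xM => [/mapP[v vM ->] F0|]; last first.
    by rewrite mem_nseq => /andP[_ /eqP ->]; rewrite mem_head.
  rewrite -/(F v) in F0 *; rewrite !in_cons.
  case: (ltngtP (F v) 1) => [|Fv1|->]; [lia| |by []].
  case: (eqVneq v 1) => [->|v1]; first by rewrite eqxx orbT.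
  rewrite mem_undup mem_filter Fv1 map_f ?orbT // mem_undup mem_filter.
  rewrite mem_undup in vM; rewrite vM andbT.
  by have := multl_gt0 vM; move: v1; case: (v) => [|[]].
have -> : size V = size (map predn V) by rewrite size_map.
apply: leq_trans (triangular_sum _ _) _.
- rewrite map_inj_in_uniq // => x y /V1 ? /V1 ?; lia.
- by move=> x /mapP[y /V1 ? ->]; lia.
rewrite leq_mul2l /=; apply: leq_trans (size_big_inventory A).
rewrite -/B -/P sumnE big_map; apply: leq_trans (leq_sum_undup _ _) _.
rewrite big_filter big_mkcond /= big_map.
rewrite -(sum_count_mem (undup_uniq P) (t := P)); last by move=> x; rewrite mem_undup.
rewrite [leqLHS]big_seq [leqRHS]big_seq; apply: leq_sum => v; rewrite mem_undup mem_filter.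
case/andP => v1 vB; rewrite /F count_filter.
rewrite (eq_count (a2 := pred1 v)); last first.
  by move=> x /=; case: eqP => [->|//]; rewrite v1.
by move: (count_mem v (multl B)) => c; case: (v \in B); case: ifP; lia.
Qed.

Lemma size_undup_inventory2_sqr (A : {mset nat}) :
  1 < size (undup (multl A)) ->
  size (undup (multl (inventory (inventory A)))) ^ 2 <= 8 * size (undup (multl A)).
Proof.
move=> c1; case: (size_undup_inventory2 A) => k h1 h2.
move: c1 h1 h2.
move: (size (undup (multl A))) (size (undup (multl (inventory (inventory A))))) => a b a1 h1 h2.
(* From [k = 2] on, [(k + 2) ^ 2 <= 4 * k * (k + 1)]; for [k <= 1] the square is at most [9], and
   [a >= 2]. *)
case: k h1 h2 => [|k] h1 h2; first by rewrite -mulnn; nia.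
have hb : b * b <= k.+3 * k.+3 by rewrite leq_mul.
rewrite -mulnn; nia.
Qed.


(** * The largest element *)

Lemma orbit_size_mono (S : nat -> {mset nat}) : is_orbit S ->
  {homo (fun i => size (multl (S i))) : i j / i <= j}.
Proof.
move=> hS; apply: homo_leq; [exact: leqnn | exact: leq_trans |] => i.
by rewrite hS size_multl_inventory_ge.
Qed.

Lemma leq_maxms (A : {mset nat}) x : x \in A -> x <= maxms A.
Proof. by move=> xA; exact: (@leq_bigmax_seq _ _ _ id x). Qed.

Lemma maxms_leqP (A : {mset nat}) m :
  reflect (forall x, x \in A -> x <= m) (maxms A <= m).
Proof.
apply: (iffP idP) => [h x xA|h]; first exact: leq_trans (leq_maxms xA) h.
by apply/bigmax_leqP_seq => x xA _; exact: h.
Qed.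

Lemma size_multl_le_max (A : {mset nat}) : 0 \notin A -> size (multl A) <= maxms A.
Proof.
move=> A0; rewrite size_map -[leqRHS](size_iota 1).
apply: uniq_leq_size; rewrite ?fset_uniq // => x; rewrite msuppE => xA.
rewrite mem_iota add1n ltnS leq_maxms // andbT lt0n.
by apply: contraNneq A0 => <-.
Qed.

Lemma inventory_notin0 (A : {mset nat}) : 0 \notin A -> 0 \notin inventory A.
Proof.
move=> A0; rewrite in_inventory negb_or A0; apply/negP => /multl_gt0.
by rewrite ltnn.
Qed.

Lemma multl_inventory_le (A : {mset nat}) x :
  x \in multl (inventory A) -> x <= (size (multl A)).+1.
Proof.
case/mapP => y _ ->; rewrite inventoryE -add1n leq_add //; first by case: (_ \in _).
exact: count_size.
Qed.

(* A constant multiplicity after one step forces the previous multiplicities to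
   be pairwise distinct: a repeated one gets multiplicity at least [2], and an
   element which is not a multiplicity gets multiplicity [1]. *)
Lemma constant_multl_inventory (A : {mset nat}) x :
  count_mem x (multl (inventory A)) = size (multl (inventory A)) ->
  uniq (multl A).
Proof.
move/eqP; rewrite -all_count => /allP ax; apply: contraT => nu.
have cst y z : y \in inventory A -> z \in inventory A -> inventory A y = inventory A z.
  rewrite -!msuppE => yA zA; rewrite (eqP (ax _ (map_f _ yA))).
  by rewrite (eqP (ax _ (map_f _ zA))).
have [v vM v2] : exists2 v, v \in multl A & 1 < count_mem v (multl A).
  apply/hasP; apply: contraR nu => /hasPn h; apply: count_mem_uniq => v.
  case: (boolP (v \in _)) => [vM|/count_memPn -> //]; have := h v vM.
  by move: vM; rewrite -has_pred1 has_count => /=; case: count => [|[]].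
have [y yA yM] : exists2 y, y \in A & y \notin multl A.
  have : ~~ all [in multl A] (finsupp A).
    apply: contra nu => /allP h; apply: (@leq_size_uniq _ (finsupp A)).
    - exact: fset_uniq.
    - exact: h.
    - by rewrite size_map.
  by case/allPn => y; rewrite msuppE => yA yM; exists y.
have := cst v y; rewrite !in_inventory vM yA orbT !inventoryE yA (count_memPn yM) => /(_ isT isT).
by move: v2; case: (v \in A); case: (count_mem v _) => [|[]].
Qed.

(** An entry above the bound forces all multiplicities at [i.+2] to be equal. Those at [i.+1] are
    then distinct with sum at most twice their number, so there are at most [3] of them and at most
    [6] elements at [i.+2]; but an entry above [7] needs at least [7]. *)
Lemma multl_le_max (S : nat -> {mset nat}) i : is_orbit S -> 0 \notin S 0 ->
  forall x, x \in multl (S i.+3) -> x <= maxn (maxms (S i.+3)) 7.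
Proof.
move=> hS S0 x xM; rewrite leqNgt; apply/negP => hx.
have S0i k : 0 \notin S k by elim: k => // k; rewrite hS; exact: inventory_notin0.
have n3 := size_multl_le_max (S0i i.+3).
have /= n23 := orbit_size_mono hS (leqnSn i.+2).
have [y [cy n7]] : exists y, count_mem y (multl (S i.+2)) = size (multl (S i.+2)) /\
    7 <= size (multl (S i.+2)).
  case/mapP: xM hx => y _ -> hx; exists y.
  have := inventoryE (S i.+2) y; rewrite -hS => e.
  have := count_size (pred1 y) (multl (S i.+2)).
  move: hx; rewrite e; move: (count_mem y _) n3 n23 => c; case: (y \in S i.+2) => /=; lia.
move: cy; rewrite hS => /constant_multl_inventory u1.
have := triangular_sum u1 (@multl_gt0 _); rewrite hS sumn_multl_inventory -hS.
have /= n01 := orbit_size_mono hS (leqnSn i).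
have := size_multl_inventory_le (S i.+1); rewrite -hS undup_id //.
move: n01 n7 => /=; nia.
Qed.

(** A new element is a multiplicity, hence at most one more than an earlier size. So the two steps
    from [S 1] to [S 3] add at most one each; afterwards [multl_le_max] applies. *)
Lemma maxms_orbit_le (S : nat -> {mset nat}) i : is_orbit S -> 0 \notin S 0 ->
  maxms (S i.+1) <= maxn (maxms (S 1)).+2 7.
Proof.
move=> hS S0.
have S0i k : 0 \notin S k by elim: k => // k; rewrite hS; exact: inventory_notin0.
have step k : maxms (S k.+2) <= (maxms (S k.+1)).+1.
  apply/maxms_leqP => x; rewrite hS in_inventory => /orP[/leq_maxms/leqW //|].
  rewrite hS => /multl_inventory_le; rewrite -hS => /leq_trans -> //; rewrite ltnS.
  by apply: leq_trans (orbit_size_mono hS (leqnSn k)) (size_multl_le_max _).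
have h2 := step 0; have h3 := step 1.
case: i => [|[|]]; [by lia..|].
elim=> [|i IH]; first by lia.
apply/maxms_leqP => x; rewrite hS in_inventory => /orP[/leq_maxms/leq_trans -> //|].
by move/(multl_le_max hS S0); lia.
Qed.

(** * Few distinct elements *)

Lemma orbit_iter (S : nat -> {mset nat}) i k : is_orbit S ->
  S (k + i) = iter k inventory (S i).
Proof. by move=> hS; elim: k => //= k IH; rewrite addSn hS IH. Qed.

Lemma in_loop_eq (S : nat -> {mset nat}) i j : is_orbit S ->
  i < j -> S j = S i -> in_loop (S i).
Proof.
move=> hS ij e; exists (j - i); split; first by lia.
by rewrite -orbit_iter // subnK // ltnW.
Qed.

Lemma no_gain_eq (A : {mset nat}) :
  size (multl (inventory A)) <= size (multl A) -> A =i inventory A.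
Proof.
rewrite !size_map => h x; rewrite -!msuppE.
have [] := @uniq_min_size _ (finsupp A) (finsupp (inventory A)) _ _ h => //.
by move=> y; rewrite !msuppE in_inventory => ->.
Qed.

Lemma no_gain_multl_sub (A : {mset nat}) :
  A =i inventory A -> {subset multl A <= A}.
Proof. by move=> e x xM; rewrite e in_inventory xM orbT. Qed.

(** The evolution of the multiplicities while no element is new: every entry of [M] is then present,
    whence the successor. Sorting turns recurrence into equality of lists. *)
Definition quiet (M : seq nat) : seq nat :=
  sort leq ([seq (count_mem v M).+1 | v <- undup M] ++
            nseq (size M - size (undup M)) 1).

Lemma perm_sort_leq (s t : seq nat) : perm_eq s t -> sort leq s = sort leq t.
Proof.
by move=> st; apply/perm_sortP => //; [exact: leq_total | exact: leq_trans | exact: anti_leq].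
Qed.

Lemma eq_quiet (M N : seq nat) : perm_eq M N -> quiet M = quiet N.
Proof.
move=> MN; apply: perm_sort_leq.
rewrite (perm_size MN) (perm_size (perm_undup (perm_mem MN))) perm_cat2r.
have /eq_map -> : (fun v => (count_mem v M).+1) =1 (fun v => (count_mem v N).+1).
  by move=> v; rewrite (permP MN).
by apply/perm_map/perm_undup/(perm_mem MN).
Qed.

Lemma quiet_multl (A : {mset nat}) : A =i inventory A ->
  sort leq (multl (inventory A)) = quiet (sort leq (multl A)).
Proof.
move=> e; have sM := no_gain_multl_sub e.
rewrite (eq_quiet (N := multl A)) ?perm_sort //.
apply: perm_sort_leq; apply: perm_trans (perm_multl_inventory A) _.
have -> : [seq (v \in A) + count_mem v (multl A) | v <- undup (multl A)] =
          [seq (count_mem v (multl A)).+1 | v <- undup (multl A)].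
  by apply/eq_in_map => v; rewrite mem_undup => /sM ->.
suff -> : count [predC multl A] (finsupp A) = size (multl A) - size (undup (multl A)) by [].
apply/(canRL (addKn _)); rewrite [in RHS]size_map.
rewrite -(count_predC [in multl A] (finsupp A)); congr (_ + _).
rewrite -size_filter; apply/perm_size/uniq_perm; rewrite ?undup_uniq ?filter_uniq ?fset_uniq //.
move=> x; rewrite mem_undup mem_filter msuppE andb_idr //; exact: sM.
Qed.

Lemma quiet_stretch (S : nat -> {mset nat}) i T : is_orbit S ->
  size (multl (S (T + i))) <= size (multl (S i)) ->
  forall k, k <= T ->
    S (k + i) =i S i /\ sort leq (multl (S (k + i))) = iter k quiet (sort leq (multl (S i))).
Proof.
move=> hS hT; elim=> [//|k IH] kT; have [eD eM] := IH (ltnW kT).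
have /= m1 := orbit_size_mono hS (leq_addl k i).
have /= m2 : size (multl (S (k.+1 + i))) <= size (multl (S (T + i))).
  by apply: orbit_size_mono => //; lia.
have e : S (k + i) =i inventory (S (k + i)).
  by apply: no_gain_eq; rewrite -hS -addSn; lia.
rewrite addSn hS; split; first by move=> x; rewrite -e eD.
by rewrite (quiet_multl e) eM.
Qed.

Lemma quiet_loop (S : nat -> {mset nat}) i T : is_orbit S ->
  size (multl (S (T + i))) <= size (multl (S i)) ->
  looping quiet (sort leq (multl (S i))) T ->
  exists2 r, r < T & in_loop (S (r.+1 + i)).
Proof.
move=> hS hT /trajectP[r rT e]; exists r => //.
have [D1 M1] := quiet_stretch hS hT (leqnn T).
have [D2 M2] := quiet_stretch hS hT (ltnW rT).
(* Equal supports and equal multiplicities identify only the inventories, so the loop is asserted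
   one index later. *)
apply: (@in_loop_eq _ _ (T.+1 + i)) => //; first by lia.
rewrite !addSn !hS; apply: eq_inventory => [x|]; first by rewrite D1 D2.
by rewrite -(perm_sort leq) perm_sym -(perm_sort leq) M1 M2 e.
Qed.

(** Nondecreasing lists give one representative per multiset, the one that [sort leq] returns. They
    are tested as they are built and never collected. *)
Fixpoint all_partitions (P : pred (seq nat)) (k e lo : nat) (acc : seq nat) : bool :=
  if k is k'.+1 then
    all (fun a => all_partitions P k' (e - a) a (rcons acc a)) (iota lo (e.+1 - lo))
  else P acc.

Lemma all_partitionsP (P : pred (seq nat)) (s : seq nat) (e lo : nat) (acc : seq nat) :
  path leq lo s -> sumn s <= e -> all_partitions P (size s) e lo acc -> P (acc ++ s).
Proof.
elim: s e lo acc => [|a s IH] e lo acc /=; first by rewrite cats0.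
move=> /andP[loa pa] se /allP /(_ a); rewrite -cat_rcons => h.
apply: (IH (e - a) a) => //; first by lia.
by apply: h; rewrite mem_iota; lia.
Qed.

(** A time by which the quiet orbit of any list of [n < 9] positive entries with sum at most [2 * n]
    repeats; [quiet_looping] checks this by enumeration. *)
Definition quiet_time (n : nat) : nat := minn n.+1 7.

Lemma quiet_looping (n : nat) : n < 9 ->
  all_partitions (fun M => looping quiet M (quiet_time n)) n (2 * n) 1 [::].
Proof.
have : all (fun n => all_partitions (fun M => looping quiet M (quiet_time n)) n (2 * n) 1 [::])
  (iota 0 9) by vm_compute.
by move=> /allP h n9; apply: h; rewrite mem_iota.
Qed.

(** Within [quiet_time] steps either the size grows or the quiet orbit repeats and gives a loop;
    sizes never decrease, so each is charged once. By [0 < i] the multiplicities sum to at most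
    twice their number, as the enumeration assumes. *)
Lemma small_orbit (S : nat -> {mset nat}) i : is_orbit S -> 0 < i ->
  exists2 j, i <= j <= i + \sum_(size (multl (S i)) <= m < 9) quiet_time m &
    in_loop (S j) \/ 9 <= size (multl (S j)).
Proof.
move=> hS; have [d] := ubnP (9 - size (multl (S i))).
elim: d i => // d IH i hd i0.
set n := size (multl (S i)).
case: (leqP 9 n) => n9; first by exists i; [rewrite leqnn leq_addr | right].
have lT : looping quiet (sort leq (multl (S i))) (quiet_time n).
  have := quiet_looping n9; rewrite -{2}(size_sort leq (multl (S i)) : _ = n).
  apply: (all_partitionsP (acc := [::])).
    rewrite path_min_sorted; first exact: (sort_sorted leq_total).
    by apply/allP => x; rewrite mem_sort => /multl_gt0.
  rewrite (perm_sumn (permEl (perm_sort _ _))) -(prednK i0) hS sumn_multl_inventory.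
  by have /= := orbit_size_mono hS (leq_pred i); rewrite -/n; lia.
rewrite big_ltn //.
have /= := orbit_size_mono hS (leq_addl (quiet_time n) i); rewrite -/n leq_eqVlt.
case/orP => [/eqP e|gain].
  have [|r rT lp] := @quiet_loop _ i (quiet_time n) hS _ lT; first by rewrite -e.
  by exists (r.+1 + i); [lia | left].
have [||j hj oj] := IH (quiet_time n + i); [by lia.. |].
exists j => //.
have : \sum_(size (multl (S (quiet_time n + i))) <= m < 9) quiet_time m
       <= \sum_(n.+1 <= m < 9) quiet_time m.
  case: (leqP (size (multl (S (quiet_time n + i)))) 9) => [g9|/ltnW g9].
    by rewrite [leqRHS](big_cat_nat gain g9) leq_addl.
  by rewrite big_geq.
lia.
Qed.

(** * Many distinct elements *)

(* With [n] distinct elements, [(Q, l, K)] describes the multiplicities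
   [n - l :: Q ++ [:: 1; ...; 1]], where [n - o] is present for all [o] in [K].
   In [next N h], [N] lists the entries of [Q] that are new elements, and [h]
   tells whether [n - l] is a new element. *)
Definition state := (seq nat * nat * seq nat)%type.

Definition next (N : seq nat) (h : bool) (s : state) : state :=
  let: (Q, l, K) := s in let g := size N + h in
  (sort leq [seq x <- 2 - h :: [seq count_mem v Q + (v \notin N) | v <- undup Q] | 1 < x],
   size Q + g,
   [seq o <- iota 2 2 | (g <= o) && ((o - g == l) || (o - g \in K))]).

(* The orbit without new elements returns to [(Q, l)] within two steps, and the
   large entries met on the way are already known. *)
Definition closes (s : state) : bool :=
  let: (Q, l, K) := s in let: (Q1, l1, K1) := next [::] false s in
  (l \in K) && (((Q1, l1) == (Q, l)) ||
    (l1 \in K1) && ((next [::] false (Q1, l1, K1)).1 == (Q, l))).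

(** [certified] checks that [next] does not lead out of this set of lists. *)
Definition core : seq (seq nat) :=
  [:: [::]; [:: 2]; [:: 2; 2]; [:: 3]; [:: 2; 3]; [:: 4]; [:: 2; 4];
      [:: 2; 2; 2]; [:: 2; 2; 3]].

(* The least solution of the inequalities in [certified], found by value
   iteration; rows follow [core]. *)
Definition pot_table : seq (seq nat) :=
  [:: [:: 6; 6; 5; 4; 6; 6; 5; 4; 6; 6; 4; 4; 5; 4; 5; 4; 6; 6; 5; 4; 6; 6; 5; 4; 6; 6; 5; 4];
      [:: 5; 5; 4; 3; 5; 5; 4; 3; 5; 5; 3; 3; 4; 3; 3; 3; 5; 5; 4; 3; 5; 5; 4; 3; 5; 5; 4; 3];
      [:: 4; 4; 3; 2; 4; 4; 2; 2; 4; 4; 2; 2; 3; 2; 2; 2; 4; 4; 3; 2; 4; 4; 3; 2; 4; 4; 3; 2];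
      [:: 5; 5; 4; 3; 5; 5; 4; 3; 5; 5; 3; 3; 4; 3; 3; 3; 5; 5; 4; 3; 5; 5; 4; 3; 5; 5; 4; 3];
      [:: 4; 3; 4; 1; 4; 3; 4; 1; 3; 3; 1; 1; 4; 1; 4; 1; 4; 3; 4; 1; 4; 3; 4; 1; 4; 3; 4; 1];
      [:: 5; 5; 4; 3; 5; 5; 4; 3; 5; 5; 3; 3; 4; 3; 3; 3; 5; 5; 4; 3; 5; 5; 4; 3; 5; 5; 4; 3];
      [:: 4; 3; 4; 1; 4; 3; 4; 1; 3; 3; 1; 1; 4; 1; 4; 1; 4; 3; 4; 1; 4; 3; 4; 1; 4; 3; 4; 1];
      [:: 5; 3; 5; 3; 5; 2; 5; 2; 3; 2; 3; 0; 5; 3; 5; 2; 5; 3; 5; 3; 5; 3; 5; 3; 5; 3; 5; 3];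
      [:: 4; 4; 3; 3; 4; 4; 3; 3; 4; 4; 3; 3; 3; 3; 2; 2; 4; 4; 3; 3; 4; 4; 3; 3; 4; 4; 3; 3]].

(** Each [l < 7] owns four columns, one per subset of [[:: 2; 3]]. *)
Definition pot (s : state) : nat :=
  let: (Q, l, K) := s in
  nth 0 (nth [::] pot_table (index Q core)) (4 * l + (2 \in K) + 2 * (3 \in K)).

Fixpoint sublists (T : Type) (s : seq T) : seq (seq T) :=
  if s is x :: s' then
    let r := sublists s' in [seq x :: t | t <- r] ++ r
  else [:: [::]].

Lemma filter_sublists (T : eqType) (a : pred T) (s : seq T) :
  [seq x <- s | a x] \in sublists s.
Proof.
elim: s => //= x s IH; rewrite mem_cat; case: (a x); last by rewrite IH orbT.
by rewrite map_f.
Qed.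

Definition in_range (s : state) : bool :=
  [&& s.1.1 \in core, s.1.2 < 7 & s.2 \in sublists (iota 2 2)].

(* Each new element pays for 2 steps; a new small one pays for 3 more, since each
   of 2, 3, 4 can be new only once. *)
Definition certified (s : state) : bool :=
  all (fun N => all (fun h => h && (s.1.2 \in s.2) ||
    let t := next N h s in
    in_range t &&
    if [|| N != [::], h | ~~ closes s] then
      pot t < pot s + 2 * (size N + h) + 3 * size N
    else all (fun N' => (N' == [::]) ||
           (pot (next N' false t) + 2 <= pot s + 5 * size N'))
         (sublists (undup t.1.1)))
    [:: false; true]) (sublists (undup s.1.1)).

Definition all_states : seq state :=
  [seq (p, K) | p <- [seq (Q, l) | Q <- core, l <- iota 0 7], K <- sublists (iota 2 2)].

Lemma mem_all_states s : in_range s -> s \in all_states.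
Proof.
case: s => [[Q l] K] /and3P[/= Qc l7 Ks].
apply: allpairs_f => //; apply: allpairs_f => //; first by rewrite mem_iota.
Qed.

Lemma certifiedP s : in_range s -> certified s.
Proof.
have : all certified all_states by vm_compute.
by move=> /allP h /mem_all_states /h.
Qed.

Lemma pot_le6 s : in_range s -> pot s <= 6.
Proof.
have : all (fun s => pot s <= 6) all_states by vm_compute.
by move=> /allP h /mem_all_states /h.
Qed.

Lemma core_entries Q x : Q \in core -> x \in Q -> x \in [:: 2; 3; 4].
Proof.
have : all (fun Q => all (fun x => x \in [:: 2; 3; 4]) Q) core by vm_compute.
by move=> /allP h /h /allP; apply.
Qed.

Lemma core_size Q : Q \in core -> size Q <= 3.
Proof.
have : all (fun Q : seq nat => size Q <= 3) core by vm_compute.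
by move=> /allP h /h.
Qed.

(** The bounds on [Q] and on [n - l] keep the ones, the small entries and the large entry apart, so
    that multiplicities can be counted block by block. *)
Definition describes (s : state) (A : {mset nat}) : Prop :=
  let: (Q, l, K) := s in let n := size (multl A) in
  [/\ perm_eq (multl A) (n - l :: Q ++ nseq (n - (size Q).+1) 1),
      1 \in A, size Q <= 3, all (fun x => 1 < x < 6) Q & 9 <= n] /\
  [/\ 6 <= n - l & forall o, o \in K -> n - o \in A].

Definition news (Q : seq nat) (A : {mset nat}) := [seq v <- undup Q | v \notin A].

Lemma size_multl_inventory (A : {mset nat}) :
  size (multl (inventory A)) = size (multl A) + size (news (multl A) A).
Proof.
rewrite (perm_size (perm_multl_inventory A)) size_cat size_map size_nseq.
rewrite -(size_filter [predC multl A]).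
have -> : size (undup (multl A)) =
    count [in A] (undup (multl A)) + size (news (multl A) A).
  by rewrite /news size_filter -(count_predC [in A]).
rewrite addnAC; congr (_ + _); rewrite size_map -[RHS](count_predC [in multl A]).
rewrite size_filter; congr (_ + _).
rewrite -!size_filter; apply/perm_size/uniq_perm; rewrite ?filter_uniq ?undup_uniq ?fset_uniq //.
by move=> x; rewrite !mem_filter mem_undup msuppE andbC.
Qed.


Lemma mem_news Q (A : {mset nat}) v : (v \in news Q A) = (v \notin A) && (v \in Q).
Proof. by rewrite mem_filter mem_undup. Qed.

Lemma perm_big_ones (s : seq nat) : (forall x, x \in s -> 0 < x) ->
  perm_eq s ([seq x <- s | 1 < x] ++ nseq (count_mem 1 s) 1).
Proof.
elim: s => //= x s IH s0; have {}IH := IH (fun y ys => s0 y (mem_behead (s := x :: s) ys)).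
case: x s0 => [|[|x]] s0; first by have := s0 0 (mem_head _ _).
  by rewrite /= perm_sym perm_catC /= perm_cons perm_catC perm_sym.
by rewrite /= perm_cons.
Qed.

Lemma undup_described Q l K (A : {mset nat}) : describes (Q, l, K) A ->
  perm_eq (undup (multl A)) [:: 1, size (multl A) - l & undup Q].
Proof.
move=> [[pM _ sQ /allP aQ n9] [L6 _]].
apply: uniq_perm; first exact: undup_uniq.
  rewrite /= undup_uniq andbT in_cons !mem_undup negb_or.
  rewrite -andbA; apply/and3P; split; first by lia.
    by apply/negP => /aQ.
  by apply/negP => /aQ; lia.
move=> x; rewrite mem_undup (perm_mem pM) !in_cons mem_cat mem_undup mem_nseq.
have -> : 0 < size (multl A) - (size Q).+1 by lia.
by rewrite /= orbA orbC.
Qed.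

Lemma size_inventory_described Q l K (A : {mset nat}) : describes (Q, l, K) A ->
  size (multl (inventory A)) =
  size (multl A) + (size (news Q A) + (size (multl A) - l \notin A)).
Proof.
move=> dA; rewrite size_multl_inventory /news (perm_size (perm_filter _ (undup_described dA))) /=.
by case: dA => [[_ -> _ _ _] _]; case: ifP => /= _; lia.
Qed.

(** The new multiplicity of [1] is [n - size Q], the next large entry; [n - l] gets [2 - h], an
    entry of [Q] its count plus one if it was present, and all other elements [1]. Offsets are
    measured from the new size, so they grow by the gain. *)
Lemma describes_next Q l K (A : {mset nat}) : describes (Q, l, K) A ->
  let t := next (news Q A) (size (multl A) - l \notin A) (Q, l, K) in
  size t.1.1 <= 3 -> describes t (inventory A).
Proof.
move=> dA; have uM := undup_described dA; have sB := size_inventory_described dA.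
have mA v : v \in multl A -> v \in inventory A by rewrite in_inventory => ->; rewrite orbT.
have sA v : v \in A -> v \in inventory A by rewrite in_inventory => ->.
case: (dA) => [[pM A1 sQ /allP aQ n9] [L6 hK]].
set n := size (multl A) in uM sB pM n9 L6 hK *.
set h := n - l \notin A; set N := news Q A; set B := inventory A in sB mA sA *.
rewrite -/h -/N in sB; cbv beta iota zeta delta [next describes fst].
set R := [seq _ | v <- undup Q].
set Q' := sort leq _ => sQ'.
have [cA1 cAL cAQ] : [/\ count_mem 1 (multl A) = n - (size Q).+1,
    count_mem (n - l) (multl A) = 1 &
    {in Q, forall v, count_mem v (multl A) = count_mem v Q}].
  have cnt v : count_mem v (multl A) =
     (n - l == v) + (count_mem v Q + (v == 1) * (n - (size Q).+1)).
    by rewrite (permP pM) /= count_cat count_nseq /= [1 == _]eq_sym.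
  split=> [||v vQ]; rewrite cnt.
  - by rewrite (count_memPn _); [lia | apply/negP => /aQ].
  - by rewrite eqxx (count_memPn _); [lia | apply/negP => /aQ; lia].
  - have := aQ v vQ; lia.
have eR : R = [seq (v \in A) + count_mem v (multl A) | v <- undup Q].
  apply/eq_in_map => v; rewrite mem_undup => vQ; rewrite cAQ //.
  by rewrite mem_news vQ andbT negbK addnC.
have Q'2 : all (fun x => 1 < x) Q'.
  by rewrite all_sort; apply/allP => x; rewrite mem_filter => /andP[].
have pB : perm_eq (multl B) (n - size Q :: Q' ++ nseq (n + (size N + h) - (size Q').+1) 1).
  pose T := (2 - h :: R) ++ nseq (count [predC multl A] (finsupp A)) 1.
  have pB1 : perm_eq (multl B) (n - size Q :: T).
    apply: perm_trans (perm_multl_inventory A) _; rewrite /T -cat_cons perm_cat2r.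
    apply: perm_trans (perm_map _ uM) _.
    rewrite /= -eR A1 cA1 cAL; have -> : 1 + (n - (size Q).+1) = n - size Q by lia.
    by rewrite /h; case: (_ \in A).
  apply: (perm_trans pB1); rewrite perm_cons.
  have T0 x : x \in T -> 0 < x.
    by move=> xT; apply: (@multl_gt0 B); rewrite (perm_mem pB1) in_cons xT orbT.
  have pT := perm_big_ones T0.
  have fT : perm_eq [seq x <- T | 1 < x] Q'.
    by rewrite /T filter_cat filter_nseq cats0 perm_sym perm_sort.
  have sT : size T = (size Q' + count_mem 1 T).
    by rewrite (perm_size pT) size_cat size_nseq (perm_size fT).
  have e : size (multl B) = (size T).+1 := perm_size pB1.
  rewrite sB sT in e.
  apply: (perm_trans pT).
  have -> : n + (size N + h) - (size Q').+1 = count_mem 1 T by rewrite e; lia.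
  by rewrite perm_cat2r.
split; split=> //.
- rewrite sB; have -> // : n + (size N + h) - (size Q + (size N + h)) = n - size Q by lia.
- exact: sA.
- rewrite -/Q'; apply/allP => x xQ'; rewrite (allP Q'2) //=.
  move: xQ'; rewrite mem_sort mem_filter in_cons => /andP[_ /orP[/eqP ->|]].
    by case: (h).
  case/mapP => v _ ->; apply: (@leq_ltn_trans (3 + 1)) => //; apply: leq_add.
    exact: leq_trans (count_size _ _) sQ.
  by case: (_ \notin _).
- by rewrite sB; lia.
- by rewrite sB subnDr; exact: leq_sub n9 sQ.
move=> o; rewrite mem_filter sB => /andP[/andP[go]]; rewrite -(subnBA _ go) => oK _.
case/orP: oK => [/eqP ->|/hK /sA //].
by apply: mA; rewrite (perm_mem pM) mem_head.
Qed.

(** Lists in [core] have no entries but [2], [3], [4], so this bounds the number of small elements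
    still to appear. *)
Definition absent (A : {mset nat}) : nat := size (news [:: 2; 3; 4] A).

Lemma absent_inventory Q (A : {mset nat}) : Q \in core -> {subset Q <= multl A} ->
  absent (inventory A) + size (news Q A) <= absent A.
Proof.
move=> Qc QM; rewrite /absent -size_cat; apply: uniq_leq_size.
  rewrite cat_uniq !filter_uniq ?undup_uniq //= andbT; apply/hasPn => x.
  by rewrite !mem_news in_inventory => /andP[_ /QM ->]; rewrite orbT.
move=> x; rewrite mem_cat !mem_news in_inventory negb_or.
case/orP=> [/andP[/andP[-> _] ->] // | /andP[-> /(core_entries Qc)]].
by [].
Qed.

Lemma described_sub Q l K (A : {mset nat}) : describes (Q, l, K) A ->
  {subset Q <= multl A}.
Proof.
move=> [[pM _ _ _ _] _] x xQ.
by rewrite (perm_mem pM) in_cons mem_cat xQ orbT.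
Qed.

Lemma described_perm (s t : state) (A B : {mset nat}) :
  describes s A -> describes t B -> s.1 = t.1 ->
  size (multl A) = size (multl B) -> perm_eq (multl A) (multl B).
Proof.
case: s t => [[Q l] K] [[Q' l'] K'] [[pA _ _ _ _] _] [[pB _ _ _ _] _] /= [eQ el] en.
by rewrite (perm_trans pA) // eQ el en perm_sym.
Qed.

Definition step_of (s : state) (A : {mset nat}) : state :=
  next (news s.1.1 A) (size (multl A) - s.1.2 \notin A) s.

Lemma step_of_bounds (s : state) (A : {mset nat}) : describes s A -> in_range s ->
  let N := news s.1.1 A in let h := size (multl A) - s.1.2 \notin A in
  in_range (step_of s A) /\
  if [|| N != [::], h | ~~ closes s] then
    pot (step_of s A) < pot s + 2 * (size N + h) + 3 * size N
  else all (fun N' => (N' == [::]) ||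
           (pot (next N' false (step_of s A)) + 2 <= pot s + 5 * size N'))
         (sublists (undup (step_of s A).1.1)).
Proof.
case: s => [[Q l] K] dA rA N h.
(* The case that [certified] leaves out cannot occur: offsets in [K] belong to elements that are
   present. *)
have hK : h && (l \in K) = false.
  case: dA => _ [_ hK]; rewrite /h /=; case: (boolP (l \in K)) => [/hK -> //|_].
  by rewrite andbF.
have /allP/(_ N) := certifiedP rA; rewrite filter_sublists => /(_ isT).
have hb : h \in [:: false; true] by case: (h).
move/allP/(_ h hb); cbv beta zeta; rewrite [_ && _]hK orFb.
by case/andP; rewrite /step_of; split.
Qed.

Lemma describes_step (s : state) (A : {mset nat}) : describes s A -> in_range s ->
  [/\ describes (step_of s A) (inventory A),
      size (multl (inventory A)) = size (multl A) +
        (size (news s.1.1 A) + (size (multl A) - s.1.2 \notin A)) &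
      absent (inventory A) + size (news s.1.1 A) <= absent A].
Proof.
move=> dA rA; have [/and3P[tc _ _] _] := step_of_bounds dA rA.
case: s dA rA tc => [[Q l] K] dA /and3P[/= Qc _ _] tc; split.
- apply: describes_next => //; exact: core_size tc.
- exact: size_inventory_described dA.
- exact: absent_inventory Qc (described_sub dA).
Qed.

Lemma described_known (s : state) (A : {mset nat}) o :
  describes s A -> o \in s.2 -> size (multl A) - o \in A.
Proof. by case: s => [[Q l] K] [_ [_]]; apply. Qed.

(** The weights match [certified]: a new element lowers the last term by [2], and a new small one
    lowers the middle term by [3] as well. *)
Definition mu (B : nat) (s : state) (A : {mset nat}) : nat :=
  pot s + 3 * absent A + 2 * (B - size (multl A)).

(** [mu] drops at each step unless the state closes up with no new element. Then either the orbit
    has period [1] or [2] from [i.+1] on, or a small entry is new one step later and [mu] drops by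
    at least [2] over the two steps. *)
Lemma large_orbit (S : nat -> {mset nat}) (B i : nat) (s : state) : is_orbit S ->
  (forall k, size (multl (S k)) <= B) ->
  describes s (S i) -> in_range s ->
  exists2 j, j <= i + (mu B s (S i)).+1 & in_loop (S j).
Proof.
move=> hS hB; have [m] := ubnP (mu B s (S i)).
elim: m i s => // m IH i s; rewrite ltnS => hm dS rS.
have [dT sT aT] := describes_step dS rS.
have [rT] := step_of_bounds dS rS.
set t := step_of s (S i) in dT rT *; set N := news s.1.1 (S i) in sT aT *.
set h := _ \notin _ in sT *; rewrite -!hS in dT sT aT.
have n1 := hB i.+1.
case: ifP => [_ pt|].
  have mt : mu B t (S i.+1) < mu B s (S i) by rewrite /mu; lia.
  have [|j hj lj] := IH i.+1 t _ dT rT; first exact: leq_trans mt hm.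
  by exists j => //; lia.
move=> /negbT; rewrite !negb_or !negbK => /and3P[/eqP N0 h0 cl] hall.
have hf : h = false by rewrite /h h0.
rewrite N0 hf !addn0 in sT.
have eD1 : S i =i S i.+1 by move=> x; rewrite hS; apply: no_gain_eq; rewrite -hS sT.
have [t1 | t2] : t.1 = s.1 \/ (t.1.2 \in t.2) && ((next [::] false t).1 == s.1).
  move: cl; rewrite /t /step_of -/N -/h N0 hf.
  by case: (s) => [[Q l] K] /=; case/andP => _ /orP[/eqP|]; [left|right].
  exists i.+1; first by lia.
  apply: (@in_loop_eq _ _ i.+2) => //; rewrite [LHS]hS [RHS]hS; apply: eq_inventory.
    by move=> x; rewrite eD1.
  apply: described_perm dT dS t1 _; exact: sT.
have [dU sU aU] := describes_step dT rT.
have [rU _] := step_of_bounds dT rT.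
case/andP: t2 => lK2 /eqP t2.
have h1 : (size (multl (S i.+1)) - t.1.2 \notin S i.+1) = false.
  by rewrite (described_known dT lK2).
set N' := news t.1.1 (S i.+1) in sU aU.
have eU : step_of t (S i.+1) = next N' false t by rewrite /step_of h1.
rewrite h1 addn0 in sU; rewrite eU -!hS in sU aU dU rU.
have n2 := hB i.+2.
case: (eqVneq N' [::]) => [N'0|N'n].
  rewrite N'0 addn0 in sU; rewrite N'0 in dU.
  exists i.+1; first by lia.
  apply: (@in_loop_eq _ _ i.+3) => //.
  rewrite [LHS]hS [RHS]hS.
  have eD2 : S i.+1 =i S i.+2 by move=> x; rewrite [S i.+2]hS; apply: no_gain_eq; rewrite -hS sU.
  apply: eq_inventory; first by move=> x; rewrite eD1 eD2.
  by apply: described_perm dU dS t2 _; rewrite sU sT.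
have /allP/(_ N') := hall; rewrite filter_sublists (negbTE N'n) orFb => /(_ isT) pU.
move: (size N') sU aU pU => k sU aU pU.
have mU : (mu B (next N' false t) (S i.+2)).+2 <= mu B s (S i) by rewrite /mu; lia.
have [|j hj lj] := IH i.+2 _ _ dU rU; first by lia.
by exists j => //; lia.
Qed.

(** * Entering the normal form *)

Definition big (A : {mset nat}) : seq nat := [seq x <- multl A | 1 < x].

Lemma count1_multl (A : {mset nat}) : size (multl A) = size (big A) + count_mem 1 (multl A).
Proof.
by rewrite (perm_size (perm_big_ones (@multl_gt0 A))) size_cat size_nseq.
Qed.

(** All but at most four multiplicities equal [1], and [1] is present, so its next multiplicity [L]
    is at least [9 + 1 - 4 = 6]. This is the large entry; at most three others exceed [1], and they
    are at most [1 + 4], since a value above [1] occurs at most four times. *)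
Lemma described_inventory (A : {mset nat}) : 1 \in A -> 9 <= size (multl A) ->
  0 < size (big A) <= 4 -> size (big (inventory A)) <= 4 ->
  exists Q l, sorted leq Q /\ describes (Q, l, [::]) (inventory A).
Proof.
move=> A1 n9 /andP[P0 P4] PB4; set B := inventory A in PB4 *.
pose F v := (v \in A) + count_mem v (multl A).
pose T := [seq F v | v <- undup (big A)] ++ nseq (count [predC multl A] (finsupp A)) 1.
have c1 := count1_multl A.
have mA v : v \in multl A -> v \in B by rewrite in_inventory => ->; rewrite orbT.
have M1 : 1 \in multl A by rewrite -has_pred1 has_count; lia.
have uM : perm_eq (undup (multl A)) (1 :: undup (big A)).
  apply: uniq_perm; rewrite ?undup_uniq //=.
    by rewrite mem_undup mem_filter undup_uniq.
  move=> x; rewrite in_cons !mem_undup mem_filter.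
  case: (eqVneq x 1) => [->|x1] //=; case: (boolP (x \in multl A)) => xM; rewrite ?andbF //.
  by rewrite andbT; have := multl_gt0 xM; move: x1; case: x {xM} => [|[]].
pose L := (size (multl A)).+1 - size (big A).
have pB1 : perm_eq (multl B) (L :: T).
  apply: perm_trans (perm_multl_inventory A) _; rewrite /T -cat_cons perm_cat2r.
  apply: perm_trans (perm_map _ uM) _.
  by rewrite /= A1 (_ : 1 + _ = L) // /L c1 -addnS addKn.
pose Q := sort leq [seq x <- T | 1 < x].
have T0 x : x \in T -> 0 < x.
  by move=> xT; apply: (@multl_gt0 B); rewrite (perm_mem pB1) in_cons xT orbT.
have pT : perm_eq T (Q ++ nseq (count_mem 1 T) 1).
  by apply: (perm_trans (perm_big_ones T0)); rewrite perm_cat2r perm_sym perm_sort.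
have sT : size T = (size Q + count_mem 1 T) by rewrite (perm_size pT) size_cat size_nseq.
have sB : size (multl B) = (size T).+1 := perm_size pB1.
have LA : size (multl A) <= size (multl B) := size_multl_inventory_ge A.
have L6 : 6 <= L <= size (multl B) by rewrite /L; lia.
have sQ : size Q <= 3.
  move: PB4; rewrite (perm_size (perm_filter _ pB1)) /=.
  have -> : 1 < L by lia.
  by rewrite /= size_sort ltnS.
exists Q, (size (multl B) - L); split; first exact: (sort_sorted leq_total).
rewrite /describes -/B subKn; last by case/andP: L6.
split; split => //.
- apply: (perm_trans pB1); rewrite perm_cons.
  by rewrite (_ : _ - _ = count_mem 1 T) //; lia.
- exact: mA.
- apply/allP => x; rewrite mem_sort mem_filter => /andP[x1]; rewrite x1 /=.
  rewrite mem_cat mem_nseq => /orP[/mapP[v]|/andP[_ /eqP ->] //].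
  rewrite mem_undup mem_filter => /andP[v1 _] ->.
  apply: (@leq_ltn_trans (1 + 4)) => //; apply: leq_add; first by case: (_ \in _).
  rewrite (permP (perm_big_ones (@multl_gt0 A))) count_cat count_nseq /=.
  rewrite (_ : (1 == v) = false) ?mul0n ?addn0; last by apply/eqP; lia.
  by apply: leq_trans (count_size _ _) P4.
- exact: leq_trans n9 LA.
by case/andP: L6.
Qed.

(** [next] computes the new list without [l] and [K], so dummy values stand for them. *)
Definition enters (Q : seq nat) : bool :=
  [&& all (fun x => x < 6) Q & size (undup Q) <= 2] ==>
  all (fun N => all (fun h => (next N h (Q, 0, [::])).1.1 \in core) [:: false; true])
    (sublists (undup Q)).

Lemma entersP Q : sorted leq Q -> all (fun x => 1 < x < 6) Q -> size Q <= 3 ->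
  enters Q.
Proof.
move=> sQ /allP aQ Q3.
(* Three entries of at most [5] sum to at most [15]. *)
have : all (fun k => all_partitions enters k 15 2 [::]) (iota 0 4) by vm_compute.
move=> /allP/(_ (size Q)); rewrite mem_iota /= => /(_ Q3).
apply: (all_partitionsP (acc := [::])).
  by rewrite path_min_sorted //; apply/allP => x /aQ /andP[].
have : sumn Q <= size Q * 5.
  rewrite -[size Q]count_predT sumnE -sum1_count big_distrl /= big_seq [leqRHS]big_seq.
  by apply: leq_sum => x /aQ; lia.
by move/leq_trans; apply; exact: leq_mul Q3 (leqnn 5).
Qed.

(** [1] is a multiplicity at [i], hence an element at [i.+1], which gives the normal form at [i.+2].
    There [1] and the large entry leave at most two distinct values for [Q], so one more step leads
    into [core]. *)
Lemma orbit_enters (S : nat -> {mset nat}) i : is_orbit S ->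
  9 <= size (multl (S i)) ->
  (forall k, i <= k -> size (big (S k)) <= 4) ->
  (forall k, i <= k -> size (undup (multl (S k))) <= 4) ->
  exists s, describes s (S i.+3) /\ in_range s.
Proof.
move=> hS n9 b4 c4.
have /= n01 := orbit_size_mono hS (leqnSn i).
have M1 : 1 \in multl (S i).
  by rewrite -has_pred1 has_count; have := count1_multl (S i); have := b4 i (leqnn i); lia.
have D1 : 1 \in S i.+1 by rewrite hS in_inventory M1 orbT.
(* If all multiplicities were [1], the size would double from [i] to [i.+1], but it grows by at most
   [4]. *)
have P0 : 0 < size (big (S i.+1)).
  rewrite lt0n; apply/negP => /eqP/size0nil P0.
  have := sumn_multl_inventory (S i); rewrite -hS.
  rewrite (perm_sumn (perm_big_ones (@multl_gt0 _))) -/(big _) P0 /= sumn_nseq mul1n.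
  have := count1_multl (S i.+1); rewrite P0 /=.
  have := size_multl_inventory_le (S i); rewrite -hS; have := c4 i (leqnn i); lia.
have [] := @described_inventory (S i.+1) D1 (leq_trans n9 n01).
- by rewrite P0 b4.
- by rewrite -hS b4 //; lia.
move=> Q [l [sQ]]; rewrite -hS => dQ.
have uQ : size (undup Q) <= 2.
  have := c4 i.+2; rewrite (perm_size (undup_described dQ)) /=; apply; lia.
have en : (step_of (Q, l, [::]) (S i.+2)).1.1 \in core.
  case: (dQ) => [[_ _ Q3 aQ _] _].
  have := entersP sQ aQ Q3; rewrite /enters uQ andbT.
  have -> : all (fun x => x < 6) Q by apply: sub_all aQ => x /andP[].
  rewrite implyTb => /allP/(_ (news Q (S i.+2))); rewrite filter_sublists => /(_ isT).
  by move=> /allP/(_ (size (multl (S i.+2)) - l \notin S i.+2)); apply; case: (_ \notin _).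
exists (step_of (Q, l, [::]) (S i.+2)); rewrite [S i.+3]hS; split.
  by apply: describes_next; rewrite // core_size.
apply/and3P; split => //; last exact: filter_sublists.
case: dQ => [[_ _ Q3 _ _] _]; rewrite /step_of /=.
(* The new offset is [size Q], plus at most two new small entries, plus one if the large entry is
   new. *)
apply: (@leq_ltn_trans (3 + (2 + 1))) => //; apply: leq_add => //; apply: leq_add.
  by rewrite size_filter (leq_trans (count_size _ _)).
by case: (_ \notin _).
Qed.

(** * The bound on the pre-period *)

Lemma size_undup_orbit2 (S : nat -> {mset nat}) i m k : is_orbit S ->
  2 * m < k.+1 * k.+2 -> size (undup (multl (S i))) <= m ->
  size (undup (multl (S i.+2))) <= k.+2.
Proof.
move=> hS mk cm; rewrite !hS; have [k' h1 h2] := size_undup_inventory2 (S i).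
apply: leq_trans h2 _; rewrite !ltnS leqNgt; apply/negP => kk'.
have : k.+1 * k.+2 <= k' * k'.+1 by apply: leq_mul; rewrite ?ltnS.
by move: h1 mk cm; lia.
Qed.

(** Two steps at a time the bound runs through [11], [6], [5], [4] and then stays. One parity starts
    at [t], the other at [t.+1], where the bound is [11]. *)
Lemma size_undup_orbit_le4 (S : nat -> {mset nat}) t k : is_orbit S ->
  size (undup (multl (S t))) <= 10 -> t + 6 <= k -> size (undup (multl (S k))) <= 4.
Proof.
move=> hS ct tk.
have six i : size (undup (multl (S i))) <= 11 -> size (undup (multl (S i.+4.+2))) <= 4.
  move=> c11; apply: (@size_undup_orbit2 _ _ 5) => //.
  by apply: (@size_undup_orbit2 _ _ 6) => //; apply: (@size_undup_orbit2 _ _ 11).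
have keep i m : size (undup (multl (S i))) <= 4 ->
    size (undup (multl (S (m.*2 + i)))) <= 4.
  by move=> c4; elim: m => // m IH; rewrite doubleS; exact: (@size_undup_orbit2 _ _ 4).
have ct1 : size (undup (multl (S t.+1))) <= 11.
  by rewrite hS; apply: leq_trans (size_undup_inventory _) _.
have := odd_double_half (k - (t + 6)); case: (odd _) => /= e.
  by rewrite (_ : k = (k - (t + 6))./2.*2 + (t.+1).+4.+2) ?keep ?six //; lia.
by rewrite (_ : k = (k - (t + 6))./2.*2 + t.+4.+2) ?keep ?six //; lia.
Qed.

(** The final bound credits two steps per element; the worst cases are [41 + 2] for [n = 1] and
    [39 + 4] for [n = 2]. *)
Lemma sum_quiet_time n : 0 < n < 9 -> \sum_(n <= m < 9) quiet_time m + 2 * n <= 43.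
Proof.
have : all (fun n => \sum_(n <= m < 9) quiet_time m + 2 * n <= 43) (iota 1 8).
  by rewrite unlock; vm_compute.
by move=> /allP h n9; apply: h; rewrite mem_iota.
Qed.

(** Seven steps leave at most four entries above [1], [E] more give a loop or size [9], three reach
    the normal form, and [mu] plus one a loop. With [pot <= 6], [absent <= 3] and
    [B = maxms (S 1) + 2] the last case totals [t + 30 + E + 2 * maxms (S 1) - 2 * n], where
    [n >= 9] is the size at [j1.+3]; [sum_quiet_time] bounds [E]. *)
Lemma orbit_loop (S : nat -> {mset nat}) t : is_orbit S -> posmset (S 0) ->
  size (undup (multl (S t))) <= 10 ->
  exists2 j, in_loop (S j) & j + 2 * size (multl (S 1)) <= t + 2 * maxms (S 1) + 60.
Proof.
move=> hS [S0n S00] ct.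
have S10 : 0 \notin S 1 by rewrite hS; exact: inventory_notin0.
have n1 := size_multl_le_max S10.
have n1gt : 0 < size (multl (S 1)).
  apply: leq_trans (orbit_size_mono hS (leqnSn 0)); rewrite lt0n; apply/negP.
  rewrite size_map => /eqP/size0nil e; apply: S0n; apply/msetP => x.
  apply/eqP; rewrite mset0E mset_eq0 -msuppE; apply/negP => xS.
  by have : x \in enum_fset (finsupp (S 0)) by []; rewrite e.
have c4 k : t + 6 <= k -> size (undup (multl (S k))) <= 4 by exact: size_undup_orbit_le4.
have b4 k : t + 7 <= k -> size (big (S k)) <= 4.
  case: k => [|k] tk; first by lia.
  by rewrite hS; apply: leq_trans (size_big_inventory _) (c4 _ _); lia.
have /= nt := orbit_size_mono hS (leq_trans (isT : 1 <= 7) (leq_addl t 7)).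
have [|j1 /andP[tj1 j1E] hj1] := @small_orbit S (t + 7) hS; first by lia.
have E43 := @sum_quiet_time (size (multl (S (t + 7)))).
have E0 : 9 <= size (multl (S (t + 7))) -> \sum_(size (multl (S (t + 7))) <= m < 9) quiet_time m = 0.
  by move=> ?; rewrite big_geq.
move: (\sum_(_ <= _ < _) _) j1E E43 E0 => E j1E E43 E0.
case: hj1 => [lj|n9].
  by exists j1 => //; lia.
have [||s [ds rs]] := orbit_enters hS n9.
- by move=> k jk; apply: b4; lia.
- by move=> k jk; apply: c4; lia.
pose B := maxn (maxms (S 1)).+2 7.
have hB k : size (multl (S k)) <= B.
  have /= nk := orbit_size_mono hS (leqnSn k); apply: leq_trans nk _.
  apply: leq_trans (size_multl_le_max _) (maxms_orbit_le _ hS S00).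
  by elim: k.+1 => // k' IH; rewrite hS; exact: inventory_notin0.
have [j jm lj] := large_orbit hS hB ds rs.
exists j => //.
have p6 := pot_le6 rs.
have a3 : absent (S j1.+3) <= 3.
  by rewrite /absent /news size_filter; apply: leq_trans (count_size _ _) _.
have nj : size (multl (S j1)) <= size (multl (S j1.+3)).
  exact: orbit_size_mono hS _ _ (leq_addl 3 j1).
have /= ntj := orbit_size_mono hS tj1.
have := hB j1.+3; move: jm; rewrite /mu /B addSn; lia.
Qed.

(** Two steps replace [c / 8] by at most its square root. As [c] is still at least [11] after [v]
    double steps, [(11 / 8) ^ (2 ^ v) <= c / 8], stated here without denominators. *)
Lemma double_log_decay (A : {mset nat}) : 10 < size (undup (multl A)) ->
  exists2 v, size (undup (multl (iter v.+1.*2 inventory A))) <= 10 &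
    8 * 11 ^ (2 ^ v) <= size (undup (multl A)) * 8 ^ (2 ^ v).
Proof.
have [m] := ubnP (size (undup (multl A))); elim: m A => // m IH A hm c10.
have h := size_undup_inventory2_sqr (leq_trans (isT : 2 <= 11) c10).
set c := size _ in hm c10 h *.
case: (leqP (size (undup (multl (inventory (inventory A))))) 10) => [c'|c'].
  by exists 0 => //; lia.
have [|v hv1 hv2] := IH _ _ c'; first by rewrite -mulnn in h; nia.
exists v.+1; first by move: hv1; rewrite -!iterSr.
rewrite -mulnn in h; rewrite expnS [2 * _]mulnC !expnM -![(_ ^ _) ^ 2]mulnn.
move: (11 ^ _) (8 ^ _) (size _) hv2 h => a b k hv2 h.
have := leq_mul hv2 hv2; have := leq_mul h (leqnn (b * b)); nia.
Qed.

Local Open Scope ring_scope.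

Lemma double_log_bound (R : realType) (S : nat -> {mset nat}) : is_orbit S ->
  exists2 t : nat, (size (undup (multl (S t))) <= 10)%N &
    (t%:R : R) <= 2 + logb (Num.sqrt 2)
      (logb (5 / 4) ((maxn (size (undup (multl (S 0%N)))) 10)%:R / 8)).
Proof.
move=> hS; set c := size _.
have ln54 : 0 < ln (5 / 4 : R) by apply: ln_gt0; lra.
have ln2 : 0 < ln (2 : R) by apply: ln_gt0; lra.
case: (leqP c 10) => c10.
  exists 0%N => //; rewrite /logb.
  (* The maximum with [10] makes the inner logarithm [1] and the outer one [0]. *)
  have -> : 10 / 8 = 5 / 4 :> R by lra.
  by rewrite divff ?gt_eqF // ln1 mul0r addr0.
have [v hv1 hv2] := double_log_decay c10.
exists v.+1.*2; first by rewrite -[v.+1.*2]addn0 orbit_iter.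
rewrite /logb; set X : R := ln _ / ln (5 / 4).
have X2 : 2 ^+ v <= X.
  rewrite /X ler_pdivlMr // -natrX [_ * ln _]mulr_natl -lnXn; last by lra.
  rewrite ler_ln ?posrE ?exprn_gt0 ?divr_gt0 ?ltr0n //; last by lia.
  (* The base [5 / 4 = 10 / 8] is below the ratio [11 / 8] that the decay provides. *)
  apply: (@le_trans _ _ ((11 / 8) ^+ (2 ^ v)%N)).
    by apply: lerXn2r; rewrite ?nnegrE; lra.
  rewrite expr_div_n ler_pdivrMr ?exprn_gt0 // mulrAC ler_pdivlMr // mulrC.
  by rewrite -!natrX -!natrM ler_nat.
have vX : v%:R <= ln X / ln 2.
  rewrite ler_pdivlMr // mulr_natl -lnXn // ler_ln ?posrE ?exprn_gt0 //.
  exact: lt_le_trans (exprn_gt0 _ _) X2.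
(* Base [sqrt 2] doubles the binary logarithm, which pays for two steps per unit of [v]. *)
have -> : ln (Num.sqrt 2 : R) = ln 2 / 2.
  have <- : ln (Num.sqrt 2 : R) *+ 2 = ln 2 by rewrite -lnXn ?sqrtr_gt0 // sqr_sqrtr.
  by lra.
rewrite invf_div mulrCA -mul2n natrM -[v.+1]addn1 natrD; lra.
Qed.

Theorem theorem8p4 (R : realType) (S : nat -> {mset nat})
    (hS0 : posmset (S 0%N))
    (hS : forall i : nat, S i.+1 = inventory (S i)) :
  let c0 := #|` distinct (mults (S 0%N))|%N in
  exists p : nat, is_preperiod S p /\
    (p%:R : R) <=
      2 * ((maxms (S 1%N))%:R - (#|` distinct (S 1%N)|)%:R)
      + logb (Num.sqrt 2) (logb (5 / 4) ((maxn c0 10)%:R / 8))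
      + 62.
Proof.
rewrite /= card_distinct_mults -size_multl.
have [t ct tR] := @double_log_bound R S hS.
have [j lj hj] := orbit_loop hS hS0 ct.
(* Classical reflection makes [in_loop] boolean, so that a least index can be taken. *)
have exl : exists q, `[< in_loop (S q) >] by exists j; apply/asboolP.
case: (ex_minnP exl) => p /asboolP lp pmin.
exists p; split; first by split=> // q /asboolP; exact: pmin.
have pj : (p <= j)%N by apply/pmin/asboolP.
have : ((p + 2 * size (multl (S 1%N)))%:R : R) <= (t + 2 * maxms (S 1%N) + 60)%:R.
  by rewrite ler_nat (leq_trans _ hj) // leq_add2r.
rewrite !natrD; lra.
Qed.
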